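(* Let $R$ be a projective-free ring, let $n\ge 1$, and let $h\in R[t]$ be a monic polynomial of degree $n$. Then the following are equivalent: (1) every $\varphi\in M_n(R)$ with $\chi(\varphi)=h$ is strongly $J^{\#}$-clean (as an element of the ring $M_n(R)$); (2) the companion matrix $C_h\in M_n(R)$ of $h$ is strongly $J^{\#}$-clean; (3) there exists a factorization $h=h_0h_1$ in $R[t]$ such that $h_0\in\mathbb{J}_0$ and $h_1\in\mathbb{J}_1$.
   Context: All rings are associative with identity. For a ring $S$, $J(S)$ denotes its Jacobson radical and $J^{\#}(S)=\{x\in S : x^k\in J(S)\text{ for some positive integer }k\}$. An element $a\in S$ is strongly $J^{\#}$-clean if there is an idempotent $e\in S$ with $a-e\in J^{\#}(S)$ and $ea=ae$. A commutative ring $R$ is projective-free if every finitely generated projective $R$-module is free. For $\varphi\in M_n(R)$, $\chi(\varphi)=\det(tI_n-\varphi)\in R[t]$ is the characteristic polynomial. For $r\in R$, $\mathbb{J}_r=\{f\in R[t] : f\text{ is monic and } f\equiv (t-r)^{\deg f}\pmod{J^{\#}(R)}\}$, where the congruence means that all coefficients of $f-(t-r)^{\deg f}$ lie in $J^{\#}(R)$ (the constant polynomial $1$ is monic of degree $0$ and belongs to $\mathbb{J}_r$). For $h=t^n+a_{n-1}t^{n-1}+\cdots+a_1t+a_0$, the companion matrix $C_h$ is the $n\times n$ matrix with $1$'s on the subdiagonal, last column $(-a_0,-a_1,\dots,-a_{n-1})^T$, and all other entries $0$. *)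

(* Defs.v *)
From HB Require Import structures.
From mathcomp Require Import all_boot all_order all_algebra.

Set Implicit Arguments.
Unset Strict Implicit.
Unset Printing Implicit Defensive.

Import GRing.Theory.
Local Open Scope ring_scope.

(* Rings below are only required to be [pzRingType] so that the definitions
   apply to ['M[R]_n] for a variable n. Subsets are Prop-valued, hence
   arbitrary (not only decidable) ones. *)

Definition left_ideal (S : pzRingType) (I : S -> Prop) : Prop :=
  [/\ I 0,
      forall x y, I x -> I y -> I (x + y)
    & forall a x, I x -> I (a * x)].

Definition maximal_left_ideal (S : pzRingType) (I : S -> Prop) : Prop :=
  [/\ left_ideal I,
      ~ (forall x, I x)
    & forall K : S -> Prop, left_ideal K -> (forall x, I x -> K x) ->
        (forall x, K x -> I x) \/ (forall x, K x)].

Definition jacobson (S : pzRingType) (x : S) : Prop :=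
  forall I : S -> Prop, maximal_left_ideal I -> I x.

Definition jsharp (S : pzRingType) (x : S) : Prop :=
  exists2 k : nat, (0 < k)%N & jacobson (x ^+ k).

Definition strongly_jsharp_clean (S : pzRingType) (a : S) : Prop :=
  exists e : S, [/\ e * e = e, jsharp (a - e) & e * a = a * e].

Definition finitely_generated (R : nzRingType) (M : lmodType R) : Prop :=
  exists s : seq M, forall x : M,
    exists c : M -> R, x = \sum_(v <- s) c v *: v.

Definition projective (R : nzRingType) (P : lmodType R) : Prop :=
  forall (A B : lmodType R) (g : {linear A -> B}) (f : {linear P -> B}),
    (forall b : B, exists a : A, g a = b) ->
    exists l : {linear P -> A}, forall x : P, g (l x) = f x.

(* A basis is a possibly infinite subset; all sums are over finite lists. *)
Definition module_basis (R : nzRingType) (M : lmodType R) (B : M -> Prop) :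
    Prop :=
  (forall x : M, exists (s : seq M) (c : M -> R),
     (forall v, v \in s -> B v) /\ x = \sum_(v <- s) c v *: v) /\
  (forall (s : seq M) (c : M -> R),
     uniq s -> (forall v, v \in s -> B v) ->
     \sum_(v <- s) c v *: v = 0 -> forall v, v \in s -> c v = 0).

Definition free_module (R : nzRingType) (M : lmodType R) : Prop :=
  exists B : M -> Prop, module_basis B.

Definition projective_free (R : comNzRingType) : Prop :=
  forall M : lmodType R,
    finitely_generated M -> projective M -> free_module M.

(* [(size f).-1] is the degree of the nonzero polynomial f. *)
Definition in_J (R : comNzRingType) (r : R) (f : {poly R}) : Prop :=
  f \is monic /\
  forall i : nat, jsharp (f - ('X - r%:P) ^+ (size f).-1)`_i.

(* The coefficients of h are in the last column: this is the transpose of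
   MathComp's [companionmx h], with its dimension given explicitly. *)
Definition companion (R : comNzRingType) (n : nat) (h : {poly R}) : 'M[R]_n :=
  \matrix_(i < n, j < n)
    if j.+1 == n :> nat then - h`_i else (i == j.+1 :> nat)%:R.

(* Main.v *)
Require Import Defs.
From HB Require Import structures.
From mathcomp Require Import all_boot all_order all_algebra.
From mathcomp Require Import generic_quotient ring_quotient.
From mathcomp Require Import boolp classical_sets.

(** A strongly clean decomposition of a matrix [phi] splits the free module
    into two [phi]-stable summands, the image of [1 - e], on which [phi] is
    nilpotent modulo the Jacobson radical, and the image of [e], on which
    [phi - 1] is. The characteristic polynomials of the two restrictions are
    the factors [h0] and [h1]; conversely the Chinese remainder theorem
    recovers the splitting from the factors.

    All congruences modulo the radical are checked in residue fields:
    an element of [R] is in the radical iff it vanishes in all of them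
    ([jacobsonP]), and a matrix iff all its entries do ([jacobson_mx_residue],
    [jacobson_mx]).

    From a factorization to a decomposition: in each residue field [h0] is a
    power of ['X] and [h1] a power of ['X - 1], so their resultant is a unit
    and u h0 + v h1 = 1 for some u, v ([comaximal_J01]). Evaluating u h0 at
    [phi] gives the idempotent, by Cayley-Hamilton ([factorization_clean]).

    From a decomposition of the companion matrix to a factorization: instead of
    choosing bases of the two summands, the restricted characteristic
    polynomials are written as determinants of the full size [n], by extending
    the restriction with the identity on the other summand ([corner]). Their
    product is [h] for formal reasons ([det_corner_factor]). Projective-freeness
    enters by excluding nontrivial idempotents of [R]
    ([projective_free_connected]), so that the summands have constant rank
    ([det_corner_X]); this makes the factors monic and, as a matrix that is
    nilpotent over a field has a power of the variable as characteristic
    polynomial, it also determines their residues ([det_corner_in_J]). *)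

Set Implicit Arguments.
Unset Strict Implicit.
Unset Printing Implicit Defensive.

Import GRing.Theory.
Local Open Scope ring_scope.

(** * The Jacobson radical through residue fields *)

Definition surj (T U : Type) (f : T -> U) := forall y, exists x, f x = y.

Lemma kernel_maximal (R : comNzRingType) (k : fieldType)
    (p : {rmorphism R -> k}) :
  surj p -> maximal_left_ideal (fun x => p x = 0).
Proof.
move=> psurj; split.
- split=> [|x y px py|a x px]; first exact: rmorph0.
    by rewrite rmorphD px py addr0.
  by rewrite rmorphM px mulr0.
- by move=> /(_ 1) /eqP; rewrite rmorph1 oner_eq0.
- move=> K [K0 KD KM] kerK; have [[x Kx /eqP px]|Kker] :=
    EM (exists2 x, K x & p x <> 0); last first.
    by left=> x Kx; apply: contrapT => px; apply: Kker; exists x.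
  right=> z; have [y py] := psurj (p x)^-1.
  have K1 : K 1.
    rewrite -[1](subrK (y * x)); apply: KD; last exact: KM.
    by apply: kerK; rewrite rmorphB rmorph1 rmorphM py mulVf ?subrr.
  by rewrite -[z]mulr1; apply: KM.
Qed.

Lemma maximal_left_ideal_compl (S : pzRingType) (I : S -> Prop) (a : S) :
  maximal_left_ideal I -> ~ I a -> exists i r, I i /\ 1 = i + r * a.
Proof.
move=> [[I0 ID IM] _ Imax] nIa.
have [||KI|K1] := Imax (fun z => exists2 i, I i & exists r, z = i + r * a).
- split; first by exists 0 => //; exists 0; rewrite mul0r addr0.
    move=> _ _ [i Ii [r ->]] [j Ij [t ->]]; exists (i + j); first exact: ID.
    by exists (r + t); rewrite mulrDl addrACA.
  move=> b _ [i Ii [r ->]]; exists (b * i); first exact: IM.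
  by exists (b * r); rewrite mulrDr mulrA.
- by move=> z Iz; exists z => //; exists 0; rewrite mul0r addr0.
- by case: nIa; apply: KI; exists 0 => //; exists 1; rewrite mul1r add0r.
- by have [i Ii [r iE]] := K1 1; exists i, r.
Qed.

(** Membership in [I] is made boolean by excluded middle in order to form the
    quotient ring, and the inverses in the quotient are obtained by choice. *)
Lemma residue_field (R : comNzRingType) (I : R -> Prop) :
  maximal_left_ideal I ->
  exists (k : fieldType) (p : {rmorphism R -> k}),
    surj p /\ forall x, I x <-> p x = 0.
Proof.
move=> Imax; have [[I0 ID IM] Iproper _] := Imax.
have I1 : ~ I 1 by move=> I1; apply: Iproper => x; rewrite -[x]mulr1; apply: IM.
pose S (x : R) := `[< I x >].
have Sclosed : idealr_closed S.
  split; first exact/asboolP.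
    exact/asboolP.
  move=> a x y /asboolP Ix /asboolP Iy; apply/asboolP; apply: ID => //.
  exact: IM.
pose mS := isIdealr.Build R S Sclosed.
pose SI : idealr R := HB.pack S mS.
pose Q := {ideal_quot SI}.
pose pi : {rmorphism R -> Q} := \pi_Q%qT.
have reprpiK y : pi (repr y) = y by exact: reprK.
have pi_eq0 x : pi x = 0 <-> I x.
  have -> : (0 : Q) = pi 0 by rewrite rmorph0.
  split=> [/eqP|Ix]; last apply/eqP.
    by rewrite -[_ == _]Quotient.idealrBE subr0 => /asboolP.
  by rewrite -[_ == _]Quotient.idealrBE subr0; apply/asboolP.
have inv_ex (y : Q) : exists z, y <> 0 -> z * y = 1.
  have [->|y0] := pselect (y = 0); first by exists 0.
  pose x := repr y.
  have yE : y = pi x by rewrite reprpiK.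
  have nIx : ~ I x by move=> /pi_eq0 x0; apply: y0; rewrite yE.
  have [i [r [Ii rE]]] := maximal_left_ideal_compl Imax nIx.
  exists (pi r) => _; have /pi_eq0 pi_i := Ii.
  by rewrite yE -rmorphM -(rmorph1 pi) rE rmorphD pi_i add0r.
have [inv invP] := choice inv_ex.
pose inv' (y : Q) := if y == 0 then 0 else inv y.
have invV (y : Q) : y != 0 -> inv' y * y = 1.
  by rewrite /inv' => y0; rewrite (negPf y0); apply: invP; apply/eqP.
have inv0 : inv' 0 = 0 by rewrite /inv' eqxx.
pose mF := GRing.ComNzRing_isField.Build Q invV inv0.
pose k : fieldType := HB.pack Q mF.
exists k, pi; split; last first.
  by move=> x; split=> /pi_eq0.
by move=> y; exists (repr (y : Q)); apply: reprpiK.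
Qed.

(** This turns every question about [jacobson] over [R] into an identity
    over fields, where it can be tested one residue field at a time. *)
Lemma jacobsonP (R : comNzRingType) (x : R) :
  jacobson x <->
  forall (k : fieldType) (p : {rmorphism R -> k}), surj p -> p x = 0.
Proof.
split=> [Jx k p psurj|px I /residue_field [k [p [psurj ->]]]]; last exact: px.
by apply: (Jx (fun y => p y = 0)); exact: kernel_maximal.
Qed.

(** An element that lies in no maximal ideal is invertible: otherwise it
    generates a proper ideal, which Zorn's lemma extends to a maximal one. *)
Lemma unit_residueP (R : comNzRingType) (u : R) :
  (forall (k : fieldType) (p : {rmorphism R -> k}), surj p -> p u != 0) ->
  exists v, v * u = 1.
Proof.
move=> pu; apply: contrapT => nu.
(* The empty chain has an empty union, which is not an ideal; adjoining the
   ideal (u) to every set turns it into the proper ideal (u). *)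
pose span (A : set R) := (A `|` [set r * u | r in [set: R]])%classic.
pose P (A : set R) := left_ideal (span A) /\ ~ span A 1.
have [F FP Ftot|M [[Mid M1] Mmax]] := @Zorn_bigcup R P.
  have [[A0 FA0]|F0] := EM (exists A, F A); last first.
    have -> : (\bigcup_(X in F) X = set0)%classic.
      by rewrite -subset0 => x [X FX]; case: F0; exists X.
    rewrite /P /span set0U; split; last by move=> [v _ uv]; apply: nu; exists v.
    split; first by exists 0; rewrite ?mul0r.
      by move=> _ _ [a _ <-] [b _ <-]; exists (a + b); rewrite ?mulrDl.
    by move=> a _ [b _ <-]; exists (a * b); rewrite ?mulrA.
  have spanF x :
      span (\bigcup_(X in F) X)%classic x <-> exists2 X, F X & span X x.
    split=> [[[X FX Xx]|ux]|[X FX [Xx|ux]]].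
    - by exists X => //; left.
    - by exists A0 => //; right.
    - by left; exists X.
    - by right.
  split; last by move=> /spanF [X /FP [_ X1]] /X1.
  split.
  - by apply/spanF; exists A0 => //; case: (FP _ FA0) => [[]].
  - move=> x y /spanF [X FX Xx] /spanF [Y FY Yy]; apply/spanF.
    have mono (B C : set R) z : (B `<=` C)%classic -> span B z -> span C z.
      by move=> BC [Bz|Uz]; [left; apply: BC | right].
    have [XY|YX] := Ftot _ _ FX FY.
      exists Y => //; have [[_ H _] _] := FP _ FY.
      by apply: H => //; apply: mono Xx.
    exists X => //; have [[_ H _] _] := FP _ FX.
    by apply: H => //; apply: mono Yy.
  - move=> a x /spanF [X FX Xx]; apply/spanF; exists X => //.
    by have [[_ _ H] _] := FP _ FX; apply: H.
have Mmaximal : maximal_left_ideal (span M).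
  split; [exact: Mid | by move=> all1; exact: (M1 (all1 1)) |].
  move=> K Kid MK.
  have [K1|K1] := EM (K 1).
    by right=> x; rewrite -[x]mulr1; case: Kid => _ _; apply.
  left=> x Kx; apply: contrapT => nMx; apply: (Mmax K).
    rewrite properEneq; split=> [|y My]; last by apply: MK; left.
    by apply/eqP => MKE; apply: nMx; left; rewrite MKE.
  have spanK : span K = K.
    by apply/seteqP; split=> y; [case=> // uy; apply: MK; right | left].
  by rewrite /P spanK.
have [k [p [psurj pM]]] := residue_field Mmaximal.
have := pu k p psurj; rewrite (_ : p u = 0) ?eqxx //; apply/pM.
by right; exists 1; rewrite ?mul1r.
Qed.

(** * The Jacobson radical of a matrix ring *)
Lemma jacobson_mull (S : pzRingType) (a x : S) : jacobson x -> jacobson (a * x).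
Proof.
by move=> Jx I Imax; have [[_ _ IM] _ _] := Imax; apply: IM; exact: Jx.
Qed.

Lemma jsharp_comm_mul (S : pzRingType) (x y : S) :
  GRing.comm x y -> jsharp x -> jsharp (x * y).
Proof.
move=> xy [k k0 Jxk]; exists k => //; rewrite exprMn_comm //.
have -> : GRing.comm (x ^+ k) (y ^+ k).
  exact/commrX/commr_sym/commrX/commr_sym.
exact: jacobson_mull.
Qed.

(** In the commutative case the passage from [jacobson] to [jsharp] adds
    nothing, since a residue field has no nonzero nilpotents. *)
Lemma jsharp_residue (R : comNzRingType) (x : R) (k : fieldType)
  (p : {rmorphism R -> k}) : surj p -> jsharp x -> p x = 0.
Proof.
move=> psurj [m m0 /jacobsonP /(_ _ _ psurj)].
by rewrite rmorphXn => /eqP; rewrite expf_eq0 m0 => /eqP.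
Qed.

(** For each column [j], the matrices whose [j]-th column vanishes in a given
    residue field form a maximal left ideal: from a matrix [A] outside it, with
    a nonzero residue in position [(i, j)], a multiple of an elementary matrix
    produces an element congruent to the identity. *)
Lemma jacobson_mx_residue (R : comNzRingType) n (A : 'M[R]_n) (k : fieldType)
    (p : {rmorphism R -> k}) :
  surj p -> jacobson A -> map_mx p A = 0.
Proof.
move=> psurj JA; apply/matrixP => i j; rewrite !mxE.
apply: (JA (fun B : 'M[R]_n => forall i, p (B i j) = 0)) => {JA A i}.
split.
- split=> [i|A B pA pB i|A B pB i]; first by rewrite mxE rmorph0.
    by rewrite mxE rmorphD pA pB addr0.
  by rewrite mxE rmorph_sum big1 // => l _; rewrite rmorphM pB mulr0.
- move=> /(_ 1 j); rewrite mxE eqxx rmorph1 => /eqP.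
  by rewrite oner_eq0.
- move=> K [K0 KD KM] kerK.
  have [[A [KA [i /eqP pA]]]|Kker] :=
    EM (exists A, K A /\ exists i, p (A i j) <> 0); last first.
    left=> A KA i; apply: contrapT => pA; apply: Kker.
    by exists A; split=> //; exists i.
  right=> B; have [y py] := psurj (p (A i j))^-1.
  have K1 : K 1.
    rewrite -[1](subrK ((y *: delta_mx j i : 'M[R]_n) * A)).
    apply: KD; last exact: KM.
    apply: kerK => l; rewrite -mulmxE -scalemxAl !mxE (bigD1 i) //=.
    rewrite big1 => [|s /negPf si]; last by rewrite mxE si andbF mul0r.
    rewrite !mxE addr0 !eqxx andbT rmorphB !rmorphM py rmorph_nat.
    by case: eqP => _; rewrite ?mul1r ?mulr0 ?mul0r ?mulr0 ?mulVf ?subrr.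
  by rewrite -[B]mulr1; apply: KM.
Qed.

(** If [A] were outside a maximal left ideal [I], then [I] would contain some
    [C = 1 - D * A]. This matrix reduces to the identity in every residue
    field, so its determinant is a unit and [I] would be everything. *)
Lemma jacobson_mx (R : comNzRingType) n (A : 'M[R]_n) :
  (forall (k : fieldType) (p : {rmorphism R -> k}),
     surj p -> map_mx p A = 0) -> jacobson A.
Proof.
move=> pA I Imax; have [[_ _ IM] Iproper _] := Imax; apply: contrapT => nIA.
have [C [D [IC CD]]] := maximal_left_ideal_compl Imax nIA.
have [|v vC] := @unit_residueP R (\det C).
  move=> k p psurj; rewrite -det_map_mx.
  have -> : C = 1 - D * A by rewrite CD addrK.
  by rewrite map_mxB map_mxM pA // mulmx0 subr0 map_mx1 det1 oner_eq0.
apply: Iproper => B; rewrite -[B]mulr1.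
have -> : 1 = (v *: \adj C) * C :> 'M[R]_n.
  by rewrite -mulmxE -scalemxAl mul_adj_mx scale_scalar_mx vC.
by apply/IM/IM.
Qed.

(** * Connectedness of projective-free rings *)
Definition connected_ring (R : pzRingType) :=
  forall e : R, e * e = e -> e = 0 \/ e = 1.

(** For an idempotent [e], the submodule of those [x] with [x * e = x] is the
    projective ideal [R e], presented by a decidable condition. *)
Section PrincipalModule.
Variables (R : comNzRingType) (e : R).

Definition fixed_by : {pred R^o} := fun x => x * e == x.

Lemma fixed_by_submod : submod_closed fixed_by.
Proof.
split=> [|a x y /eqP xe /eqP ye]; first by rewrite unfold_in mul0r.
by rewrite unfold_in mulrDl -scalerAl xe ye.
Qed.

HB.instance Definition _ :=
  GRing.isSubmodClosed.Build R R^o fixed_by fixed_by_submod.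

Record principal :=
  Principal { principal_val : R^o; _ : principal_val \in fixed_by }.

HB.instance Definition _ := [isSub for principal_val].
HB.instance Definition _ := [Choice of principal by <:].
HB.instance Definition _ := [SubChoice_isSubLmodule of principal by <:].
End PrincipalModule.

(** For an idempotent [e], the module [R e] is cyclic and projective, hence
    free. If [e] is nonzero there is a basis vector; it is killed by [1 - e],
    so independence forces [e = 1]. *)
Lemma projective_free_connected (R : comNzRingType) :
  projective_free R -> connected_ring R.
Proof.
move=> hR e ee; have [->|e0] := eqVneq e 0; [by left | right].
have e_in : (e : R^o) \in fixed_by e by rewrite unfold_in ee.
pose g : principal e := Principal e_in.
have gen (x : principal e) : x = (val x : R) *: g.
  by apply: val_inj; rewrite linearZ /=; have /eqP := valP x.
have [||B [Bgen Bfree]] := hR (principal e).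
- by exists [:: g] => x; exists (fun=> val x); rewrite big_seq1 -gen.
- move=> A B f h fsurj; have [a fa] := fsurj (h g).
  have lin : linear (fun x : principal e => (val x : R) *: a).
    by move=> c x y; rewrite linearP scalerDl -scalerA.
  pose l : {linear principal e -> A} :=
    HB.pack (fun x : principal e => (val x : R) *: a)
      (GRing.isLinear.Build _ _ _ _ _ lin).
  by exists l => x; rewrite /= linearZ /= fa -linearZ -gen.
have [s [c [sB gE]]] := Bgen g.
case: s => [|b s] in sB gE.
  by move: e0; rewrite -[e]/(val g) gE big_nil /= eqxx.
have /(_ [:: b] (fun=> 1 - e)) := Bfree.
rewrite big_seq1 => indep; apply/esym/eqP; rewrite -subr_eq0; apply/eqP.
apply: (indep _ _ _ b); rewrite ?mem_seq1 //.
  by move=> v; rewrite mem_seq1 => /eqP ->; apply: sB; rewrite mem_head.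
apply: val_inj; rewrite linearZ /= /GRing.scale /=.
by have /eqP := valP b; rewrite mulrBl mul1r mulrC => ->; rewrite subrr.
Qed.

(** * Determinants of corners *)

(** When [a] commutes with the idempotent [e], this element acts as [a] on the
    image of [e] and as the identity on the image of [1 - e]. For matrices, its
    determinant is therefore the determinant of [a] restricted to the
    projective module cut out by [e], and no basis of it has to be chosen. *)
Definition corner (S : pzRingType) (e a : S) := a * e + (1 - e).

Section Corner.
Variables (S : pzRingType) (e : S).
Hypothesis ee : e * e = e.

Let eV : e * (1 - e) = 0. Proof. by rewrite mulrBr mulr1 ee subrr. Qed.
Let Ve : (1 - e) * e = 0. Proof. by rewrite mulrBl mul1r ee subrr. Qed.

Lemma idem_compl : (1 - e) * (1 - e) = 1 - e.
Proof. by rewrite mulrBr mulr1 Ve subr0. Qed.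

Lemma cornerM a b :
  GRing.comm b e -> corner e a * corner e b = corner e (a * b).
Proof.
rewrite /corner; move: idem_compl eV Ve; move: (1 - e) => v vv ev ve be.
rewrite mulrDl !mulrDr vv -!mulrA ev mulr0 addr0 be [e * (e * b)]mulrA ee.
by rewrite [v * (e * b)]mulrA ve mul0r add0r.
Qed.

Lemma corner_compl a b :
  GRing.comm b e -> corner e a * corner (1 - e) b = a * e + b * (1 - e).
Proof.
move=> be; have : GRing.comm b (1 - e).
  by apply: commrB => //; apply: commr1.
rewrite /corner subKr; move: idem_compl eV Ve.
move: (1 - e) => v vv ev ve bv.
rewrite mulrDl !mulrDr -!mulrA ee bv [e * (v * b)]mulrA ev mul0r mulr0 add0r.
by rewrite [v * (v * b)]mulrA vv ve addr0.
Qed.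

End Corner.

Lemma det_map_corner (R A : comNzRingType) (f : {rmorphism R -> A}) n
    (F M : 'M[R]_n) :
  f (\det (corner F M)) = \det (corner (map_mx f F) (map_mx f M)).
Proof.
by rewrite -det_map_mx /corner [in LHS]map_mxD [in LHS]map_mxM map_mxB map_mx1.
Qed.

Lemma comp_poly_scaleX (R : comNzRingType) (p : {poly R}) (c : R) i :
  (p \Po (c%:P * 'X))`_i = p`_i * c ^+ i.
Proof.
have -> : p \Po (c%:P * 'X) = \poly_(j < size p) (p`_j * c ^+ j).
  rewrite comp_polyE poly_def; apply: eq_bigr => j _.
  by rewrite exprMn -polyC_exp mul_polyC scalerA.
by rewrite coef_poly; case: ltnP => // pi; rewrite nth_default // mul0r.
Qed.

Lemma map_mx_idem (R A : comNzRingType) (f : {rmorphism R -> A}) n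
    (F : 'M[R]_n) : F * F = F -> map_mx f F * map_mx f F = map_mx f F.
Proof. by move=> FF; rewrite -mulmxE -map_mxM mulmxE FF. Qed.

Lemma scalar_mx_comm (R : comNzRingType) n (c : R) (F : 'M[R]_n) :
  GRing.comm c%:M F.
Proof. by rewrite /GRing.comm -!mulmxE scalar_mxC. Qed.

(** The determinant [P] of multiplication by ['X] on the image of [F] is
    multiplicative, P(X) P(Y) = P(XY), and P(1) = 1. Hence its coefficients are
    orthogonal idempotents with sum 1, and over a connected ring exactly one of
    them survives; its index is the rank of [F]. *)
Lemma det_corner_X (R : comNzRingType) n (F : 'M[R]_n) :
  connected_ring R -> F * F = F ->
  exists a, \det (corner (map_mx polyC F) 'X%:M) = 'X^a.
Proof.
move=> conn FF; set P : {poly R} := \det _.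
pose G : 'M[{poly {poly R}}]_n := map_mx polyC (map_mx polyC F).
have GG : G * G = G by do 2!apply: map_mx_idem.
have PG : map_poly polyC P = \det (corner G 'X%:M).
  rewrite det_map_corner map_scalar_mx /= map_polyX; congr (\det (corner _ _)).
  by apply/matrixP => i j; rewrite !mxE /= map_polyC.
have PcG : P%:P = \det (corner G ('X%:P)%:M).
  by rewrite det_map_corner map_scalar_mx.
have PXY : map_poly polyC P \Po ('X%:P * 'X) =
           \det (corner G ('X%:P * 'X)%:M).
  rewrite PG [LHS]det_map_corner map_scalar_mx /= comp_polyX.
  congr (\det (corner _ _)).
  by apply/matrixP => i j; rewrite !mxE /= comp_polyC.
(* The coefficient of the i-th power of the outer variable in the identity
   P(X) P(Y) = P(XY). *)
have PP i : (P`_i)%:P * P = (P`_i)%:P * 'X^i.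
  rewrite -[X in X * _ = _](coef_map polyC) -coefMC PcG PG -det_mulmx mulmxE.
  rewrite cornerM //; last exact: scalar_mx_comm.
  by rewrite -mulmxE -scalar_mxM mulrC -PXY comp_poly_scaleX coef_map.
have Pij i j : P`_i * P`_j = P`_i * (j == i)%:R.
  by have /(congr1 (fun q : {poly R} => q`_j)) := PP i; rewrite !coefCM coefXn.
have P0 : P != 0.
  apply/eqP => P0; have : P.[1] = 1.
    rewrite -[P.[1]]/(horner_eval 1 P) det_map_corner.
    rewrite map_scalar_mx /= /horner_eval hornerX /corner mul1r.
    by rewrite addrC subrK det1.
  by rewrite P0 horner0 => /esym/eqP; rewrite oner_eq0.
exists (size P).-1; have := PP (size P).-1.
rewrite -lead_coefE.
have [||->] := conn (lead_coef P); rewrite ?mul1r //.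
  by rewrite lead_coefE Pij eqxx mulr1.
by move=> /eqP; rewrite lead_coef_eq0 (negPf P0).
Qed.

(** The matrix on the right acts as [phi] on the image of [F] and as the scalar
    [c] on its complement, of rank [b]. *)
Lemma char_poly_block (R : comNzRingType) n (phi F : 'M[R]_n) (c : R) (b : nat):
  F * F = F ->
  \det (corner (map_mx polyC (1 - F)) 'X%:M) = 'X^b ->
  \det (corner (map_mx polyC F) (char_poly_mx phi)) * ('X - c%:P) ^+ b
   = char_poly (phi * F + c%:M * (1 - F)).
Proof.
move=> FF Xb.
have -> : ('X - c%:P) ^+ b =
          \det (corner (map_mx polyC (1 - F)) ('X - c%:P)%:M).
  rewrite -comp_Xn_poly -Xb [LHS]det_map_corner map_scalar_mx /=.
  rewrite comp_polyX; congr (\det (corner _ _)).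
  by apply/matrixP => i j; rewrite !mxE /= comp_polyC.
rewrite -det_mulmx mulmxE map_mxB map_mx1 corner_compl; last 2 first.
- exact: map_mx_idem.
- exact: scalar_mx_comm.
congr (\det _); rewrite /char_poly_mx -!mulmxE.
rewrite map_mxD map_mxM map_mxM map_mxB map_mx1 map_scalar_mx /=.
rewrite rmorphB /= !mulmxE.
set Fp := map_mx _ F; set pp := map_mx _ phi.
rewrite !mulrBl !mulrBr mulr1.
rewrite addrA [X in X - _]addrC [in X in X - _]addrA subrK.
by rewrite [in RHS]opprD addrA.
Qed.

(** * Detecting membership in the sets J_r *)

Lemma in_J_monicP (R : comNzRingType) (r : R) (f : {poly R}) :
  f \is monic ->
  in_J r f <-> forall (k : fieldType) (p : {rmorphism R -> k}), surj p ->
    map_poly p f = ('X - (p r)%:P) ^+ (size f).-1.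
Proof.
move=> fm.
have mapE (k : fieldType) (p : {rmorphism R -> k}) i :
    p (f - ('X - r%:P) ^+ (size f).-1)`_i =
    (map_poly p f - ('X - (p r)%:P) ^+ (size f).-1)`_i.
  by rewrite -coef_map rmorphB rmorphXn rmorphB /= map_polyX map_polyC.
split=> [[_ fJ] k p psurj|pf].
  apply/eqP; rewrite -subr_eq0; apply/eqP/polyP => i.
  by rewrite coef0 -mapE; apply: jsharp_residue.
split=> // i; exists 1 => //; rewrite expr1; apply/jacobsonP => k p psurj.
by rewrite mapE pf // subrr coef0.
Qed.

(** Since [B := A - c] is nilpotent, ['X - c - B] divides a power of the scalar
    matrix ['X - c], so the characteristic polynomial of [A] divides a power of
    ['X - c]. *)
Lemma char_poly_shifted_nilpotent (k : fieldType) n (A : 'M[k]_n) (c : k) m :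
  (A - c%:M) ^+ m = 0 -> char_poly A = ('X - c%:P) ^+ n.
Proof.
move=> Am.
pose B := map_mx polyC (A - c%:M).
have Bm : B ^+ m = 0.
  have -> : B ^+ m = map_mx polyC ((A - c%:M) ^+ m).
    elim: (m) => [|i IH]; first by rewrite !expr0 [RHS]map_mx1.
    by rewrite !exprS IH [RHS]map_mxM.
  by rewrite Am [LHS]map_mx0.
pose X : 'M[{poly k}]_n := ('X - c%:P)%:M.
have XB : GRing.comm X B by rewrite /GRing.comm -!mulmxE scalar_mxC.
have AXB : char_poly_mx A = X - B.
  rewrite /X /B /char_poly_mx map_mxB map_scalar_mx rmorphB /=.
  by rewrite opprB addrA subrK.
have /(congr1 determinant) := subrXX_comm m XB.
rewrite Bm subr0 -AXB -mulmxE det_mulmx.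
have -> : \det (X ^+ m) = ('X - c%:P) ^+ (m * n).
  have -> : X ^+ m = (('X - c%:P) ^+ m)%:M.
    elim: (m) => [|i IH]; first by rewrite !expr0.
    by rewrite !exprS IH -mulmxE -scalar_mxM.
  by rewrite det_scalar exprM.
move=> dvdX; have : char_poly A %| ('X - c%:P) ^+ (m * n).
  by rewrite dvdX dvdp_mulr.
move=> /dvdp_exp_XsubCP [a _]; rewrite eqp_monic ?char_poly_monic //; last first.
  exact/monic_exp/monicXsubC.
move=> /eqP cA; have := size_char_poly A; rewrite cA.
by rewrite size_exp_XsubC => -[->].
Qed.

(** Extending [phi] by the scalar [c] on the complement of the image of [F]
    multiplies the determinant by a power of ['X - c] and gives a genuine
    characteristic polynomial. This shows that the determinant is monic, and
    reduces its residues to those of the matrix [N], for which [N - c] is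
    nilpotent in every residue field. *)
Lemma det_corner_in_J (R : comNzRingType) n (phi F : 'M[R]_n) (c : R) :
  connected_ring R -> F * F = F ->
  jsharp ((phi - c%:M) * F) ->
  in_J c (\det (corner (map_mx polyC F) (char_poly_mx phi))).
Proof.
move=> conn FF [m m0 Jm].
have [b Xb] := det_corner_X conn (idem_compl FF).
have qE := char_poly_block phi c FF Xb; move: (qE).
set q : {poly R} := \det _; set N := phi * F + _ => {}qE.
have XcM : ('X - c%:P) ^+ b \is monic by exact/monic_exp/monicXsubC.
have qm : q \is monic by rewrite -(monicMr _ XcM) qE char_poly_monic.
apply/in_J_monicP => // k p psurj.
have Nc : N - c%:M = (phi - c%:M) * F.
  rewrite /N mulrBl [_ * (1 - F)]mulrBr mulr1 [c%:M - _]addrC.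
  by rewrite addrA addrK.
have pN : char_poly (map_mx p N) = ('X - (p c)%:P) ^+ n.
  apply: (@char_poly_shifted_nilpotent _ _ _ _ m).
  have <- := jacobson_mx_residue psurj Jm.
  rewrite -Nc; elim: (m) => [|i IH]; first by rewrite !expr0 [RHS]map_mx1.
  by rewrite !exprS IH [RHS]map_mxM map_mxB map_scalar_mx.
have sq : n.+1 = ((size q).-1 + b).+1.
  rewrite -(size_char_poly N) -qE size_monicM ?monic_neq0 //.
  rewrite size_exp_XsubC addnS /= -addSn prednK // size_poly_gt0.
  exact: monic_neq0.
case: sq => sq; have := congr1 (map_poly p) qE.
rewrite map_char_poly pN rmorphM rmorphXn rmorphB /= map_polyX map_polyC.
rewrite sq exprD.
by apply/mulIf/monic_neq0/monic_exp/monicXsubC.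
Qed.

Lemma det_corner_factor (R : comNzRingType) n (phi F : 'M[R]_n) :
  F * F = F -> F * phi = phi * F ->
  char_poly phi = \det (corner (map_mx polyC F) (char_poly_mx phi)) *
                  \det (corner (map_mx polyC (1 - F)) (char_poly_mx phi)).
Proof.
move=> FF Fphi; rewrite -det_mulmx mulmxE map_mxB map_mx1 corner_compl.
- by rewrite -mulrDr addrC subrK mulr1.
- exact: map_mx_idem.
apply/commr_sym/commrB; first exact/commr_sym/scalar_mx_comm.
by rewrite /GRing.comm -!mulmxE -!map_mxM !mulmxE Fphi.
Qed.

(** The transpose of a companion matrix has the same characteristic polynomial,
    which reconciles the two conventions. *)
Lemma char_poly_companion (R : comNzRingType) n (h : {poly R}) :
  h \is monic -> size h = n.+1 -> char_poly (companion n h) = h.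
Proof.
move=> hm hs; have -> : n = (size h).-1 by rewrite hs.
rewrite -[RHS](companionmxK hm) /char_poly -det_tr; congr (\det _).
rewrite [LHS]linearB /= tr_scalar_mx map_trmx; congr (_ - map_mx _ _).
apply/matrixP => i j; rewrite !mxE; congr (if _ then _ else (nat_of_bool _)%:R).
  by move: (size h).-1 i {j} => [|d] [].
by rewrite eq_sym.
Qed.

(** * From a factorization to a strongly clean decomposition *)

(** Monicity keeps the degrees, hence the shape of the Sylvester matrix. *)
Lemma residue_resultant (R : comNzRingType) (k : fieldType)
    (p : {rmorphism R -> k}) (f g : {poly R}) : f \is monic -> g \is monic ->
  p (resultant f g) = resultant (map_poly p f) (map_poly p g).
Proof.
move=> fm gm; rewrite /resultant -det_map_mx /Sylvester_mx.
rewrite !size_map_poly_id0 ?(monicP fm) ?(monicP gm) ?rmorph1 ?oner_eq0 //.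
rewrite map_col_mx; congr (\det (col_mx _ _)); apply/matrixP => i j;
  by rewrite !mxE /= !rVpoly_delta !coefXnM coef_map;
     case: ifP; rewrite ?rmorph0.
Qed.

(** In a residue field the two polynomials become powers of ['X] and of
    ['X - 1], which are coprime. Hence their resultant is a unit, and it is a
    combination of the two polynomials. *)
Lemma comaximal_J01 (R : comNzRingType) (f g : {poly R}) :
  in_J 0 f -> in_J 1 g -> exists u v, u * f + v * g = 1.
Proof.
move=> Jf Jg; have [[fm _] [gm _]] := (Jf, Jg).
have [f1|sf] := leqP (size f) 1.
  exists 1, 0; rewrite mul0r mul1r addr0.
  by move: fm; rewrite (size1_polyC f1) monicE lead_coefC => /eqP ->.
have [g1|sg] := leqP (size g) 1.
  exists 0, 1; rewrite mul0r mul1r add0r.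
  by move: gm; rewrite (size1_polyC g1) monicE lead_coefC => /eqP ->.
have [[u v] /= _ uv] := resultant_in_ideal sf sg.
have [|w wres] := @unit_residueP R (resultant f g).
  move=> k p psurj.
  rewrite residue_resultant //.
  have /(in_J_monicP _ fm)/(_ _ _ psurj) -> := Jf.
  have /(in_J_monicP _ gm)/(_ _ _ psurj) -> := Jg.
  rewrite resultant_eq0 -leqNgt rmorph0 rmorph1.
  have : coprimep (('X - 0%:P) ^+ (size f).-1)
                  (('X - 1%:P : {poly k}) ^+ (size g).-1).
    apply/coprimep_expl/coprimep_expr/coprimep_XsubC2.
    by rewrite subr0 oner_eq0.
  by rewrite /coprimep => /eqP ->.
exists (w%:P * u), (w%:P * v).
by rewrite -!mulrA -mulrDr -uv -polyCM wres.
Qed.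

(** On the image of [1 - e] the element [a - e] acts as [a], and on the image of
    [e] it acts as [a - 1]. *)
Lemma expr_sub_idem (S : pzRingType) (a e : S) m :
  e * e = e -> GRing.comm a e ->
  (a - e) ^+ m = a ^+ m * (1 - e) + (a - 1) ^+ m * e.
Proof.
move=> ee ae.
have ce : GRing.comm (a - e) e by apply/commr_sym/commrB => //; exact/commr_sym.
have H1 : (a - e) ^+ m * e = (a - 1) ^+ m * e.
  elim: m => [//|m IH]; rewrite !exprSr -!mulrA.
  have -> : (a - e) * e = e * (a - 1).
    by rewrite mulrBl mulrBr mulr1 ee ae.
  have -> : (a - 1) * e = e * (a - 1).
    by rewrite mulrBl mulrBr mulr1 mul1r ae.
  by rewrite !mulrA IH.
have H0 : (a - e) ^+ m * (1 - e) = a ^+ m * (1 - e).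
  have c1 : GRing.comm a (1 - e) by apply: commrB => //; exact: commr1.
  elim: m {H1} => [//|m IH]; rewrite !exprSr -!mulrA c1 [RHS]mulrA -IH.
  rewrite -mulrA; congr (_ * _).
  by rewrite mulrBl [e * _]mulrBr mulr1 ee subrr subr0 c1.
by rewrite -H1 -H0 -mulrDr subrK mulr1.
Qed.

(** With u h0 + v h1 = 1, the matrix [e := (u h0)(phi)] is idempotent by
    Cayley-Hamilton. The complement of [e] is killed by [h0 (phi)], which is a
    power of [phi] in every residue field, and [e] is killed by [h1 (phi)],
    which is a power of [phi - 1]; so a power of [phi - e] vanishes there. *)
Lemma factorization_clean (R : comNzRingType) n (phi : 'M[R]_n.+1)
    (h0 h1 : {poly R}) :
  char_poly phi = h0 * h1 -> in_J 0 h0 -> in_J 1 h1 ->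
  strongly_jsharp_clean phi.
Proof.
move=> hE J0 J1; have [u [v uv]] := comaximal_J01 J0 J1.
pose ev := horner_mx phi.
have ev0 q : ev (q * (h0 * h1)) = 0.
  by rewrite -hE [LHS]rmorphM /= Cayley_Hamilton mulr0.
pose e := ev (u * h0).
have eC : 1 - e = ev (v * h1).
  by rewrite -(rmorph1 ev) -uv rmorphD /= addrC addKr.
have ee : e * e = e.
  apply/eqP; rewrite -subr_eq0 -oppr_eq0 opprB -[X in X - _]mulr1 -mulrBr eC.
  by rewrite -rmorphM mulrACA; apply/eqP/ev0.
have ev0C : ev h0 * (1 - e) = 0.
  by rewrite eC -rmorphM mulrCA; exact: ev0.
have ev1e : ev h1 * e = 0.
  by rewrite -rmorphM mulrCA [h1 * _]mulrC; exact: ev0.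
have e_phi : GRing.comm phi e.
  by rewrite /e -(horner_mx_X phi); apply: comm_horner_mx2.
(* Any positive exponent that is at least both degrees works. *)
pose m := ((size h0).-1 + (size h1).-1).+1.
exists e; split=> //; exists m => //.
apply: jacobson_mx => k p psurj.
rewrite expr_sub_idem //.
have evE q : map_mx p (ev q) = horner_mx (map_mx p phi) (map_poly p q).
  exact: map_horner_mx.
have expE (c : R) (q : {poly R}) d : in_J c q -> ((size q).-1 <= d)%N ->
    exists r, map_mx p ((phi - c%:M) ^+ d) = r * map_mx p (ev q).
  move=> Jq qd; have [qmon _] := Jq.
  have /(in_J_monicP _ qmon)/(_ _ _ psurj) qE := Jq.
  exists (map_mx p ((phi - c%:M) ^+ (d - (size q).-1))).
  have <- : map_mx p ((phi - c%:M) ^+ (size q).-1) = map_mx p (ev q).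
    rewrite evE qE [LHS]rmorphXn [RHS]rmorphXn; congr (_ ^+ _).
    rewrite [LHS]map_mxB map_scalar_mx [RHS]rmorphB /=.
    by rewrite horner_mx_X horner_mx_C.
  by rewrite -rmorphM -exprD subnK.
rewrite map_mxD -!mulmxE !map_mxM !mulmxE.
have [||r0] := expE 0 h0 m; rewrite /m ?leqW ?leq_addr //.
have [||r1] := expE 1 h1 m; rewrite /m ?leqW ?leq_addl //.
rewrite raddf0 subr0 => -> ->.
by rewrite -!mulrA -!mulmxE -!map_mxM !mulmxE ev0C ev1e !map_mx0 !mulr0 addr0.
Qed.

Theorem theorem2p6 (R : comNzRingType) (hR : projective_free R)
    (n : nat) (hn : (1 <= n)%N)
    (h : {poly R}) (hmonic : h \is monic) (hdeg : size h = n.+1) :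
  let clean_all := forall phi : 'M[R]_n,
    char_poly phi = h -> strongly_jsharp_clean phi in
  let clean_companion := strongly_jsharp_clean (companion n h) in
  let factorization := exists h0 h1 : {poly R},
    [/\ h = h0 * h1, in_J 0 h0 & in_J 1 h1] in
  (clean_all <-> clean_companion) /\ (clean_companion <-> factorization).
Proof.
move=> clean_all clean_companion factorization.
have all_comp : clean_all -> clean_companion.
  by apply; apply: char_poly_companion.
have fact_all : factorization -> clean_all.
  move=> [h0 [h1 [hE J0 J1]]] phi phiE.
  case: n hn {hdeg clean_all clean_companion all_comp} phi phiE => // n _ phi.
  by rewrite hE => phiE; apply: factorization_clean J0 J1.
have comp_fact : clean_companion -> factorization.
  move=> [e [ee Je ea]]; set phi := companion n h in Je ea.
  have conn := projective_free_connected hR.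
  have ff := idem_compl ee.
  have ce : GRing.comm (phi - e) e.
    by apply/commr_sym/commrB => //.
  exists (\det (corner (map_mx polyC (1 - e)) (char_poly_mx phi))),
         (\det (corner (map_mx polyC e) (char_poly_mx phi))); split.
  - by rewrite mulrC -det_corner_factor // char_poly_companion.
  - apply: det_corner_in_J => //; rewrite raddf0 subr0.
    have -> : phi * (1 - e) = (phi - e) * (1 - e).
      by rewrite [RHS]mulrBl mulrBr [e * (1 - e)]mulrBr !mulr1 ee subrr subr0.
    apply: jsharp_comm_mul => //; apply: commrB => //; exact: commr1.
  - apply: det_corner_in_J => //.
    have -> : (phi - 1%:M) * e = (phi - e) * e.
      by rewrite !mulrBl ee mul1r.
    exact: jsharp_comm_mul.
by split; split; auto.
Qed.
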